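(* Let $n\ge 2$ and for $a=(a_1,\dots,a_n)\in\mathbb{R}^n$, $b=(b_1,\dots,b_n)\in\mathbb{R}^n$ let $J=J(a,b)$ be the Jacobian of the directed $n$-node ring. The eigenvalues of $J$ are generically simple. Indeed, for any fixed $a_1,\dots,a_n$, arbitrarily small perturbations of $b_1,\dots,b_n$ remove any multiple eigenvalues; that is, for all $a,b\in\mathbb{R}^n$ and every $\varepsilon>0$ there exists $b'\in\mathbb{R}^n$ with $\|b'-b\|<\varepsilon$ such that all eigenvalues (in $\mathbb{C}$) of $J(a,b')$ are simple.
   Context: $J(a,b)$ is the real $n\times n$ matrix with $J_{jj}=a_j$ for $1\le j\le n$, $J_{j,j+1}=b_j$ for $1\le j\le n-1$, $J_{n,1}=b_n$, and all other entries $0$. It is the general form of the Jacobian of an ODE $\dot x_j=f_j(x_j,x_{j+1})$ (indices mod $n$) with each $x_j\in\mathbb{R}$ and independent functions $f_j$ (a fully inhomogeneous nearest-neighbour unidirectional ring). An eigenvalue is simple if it is a simple root of the characteristic polynomial. ''Generic'' means that the property can be realised after an arbitrarily small admissible perturbation, i.e. an arbitrarily small perturbation of the entries $a_j,b_j$. *)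

(* Defs.v *)
From HB Require Import structures.
From mathcomp Require Import all_boot all_order all_algebra.
From mathcomp Require Import reals.
From mathcomp Require Import complex.

Set Implicit Arguments.
Unset Strict Implicit.
Unset Printing Implicit Defensive.

Import Order.TTheory GRing.Theory Num.Theory.
Local Open Scope ring_scope.

(* [ordS i] is [i + 1] modulo [n], so the last row carries its off-diagonal
   entry in the first column.  For [n >= 2], [ordS i] differs from [i] and the
   order of the two tests is irrelevant. *)
Definition ring_jacobian (R : realType) (n : nat) (a b : 'rV[R]_n) : 'M[R]_n :=
  \matrix_(i < n, j < n)
    if j == i then a 0 i else if j == ordS i then b 0 i else 0.

Definition complexify (R : realType) (n : nat) (A : 'M[R]_n) : 'M[R[i]]_n :=
  map_mx (real_complex R) A.

Definition simple_eigenvalue (R : realType) (n : nat) (A : 'M[R]_n)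
    (z : R[i]) : Prop :=
  mup z (char_poly (complexify A)) = 1%N.

Definition all_eigenvalues_simple (R : realType) (n : nat) (A : 'M[R]_n)
    : Prop :=
  forall z : R[i], eigenvalue (complexify A) z -> simple_eigenvalue A z.

Definition enorm (R : realType) (n : nat) (v : 'rV[R]_n) : R :=
  Num.sqrt (\sum_(i < n) v 0 i ^+ 2).

(* The parameter space is pairs [(a, b)] in R^n x R^n = R^(n + n). *)
Definition generic (R : realType) (n : nat)
    (P : 'rV[R]_n -> 'rV[R]_n -> Prop) : Prop :=
  forall (a b : 'rV[R]_n) (eps : R), 0 < eps ->
    exists a' b' : 'rV[R]_n,
      enorm (row_mx (a' - a) (b' - b)) < eps /\ P a' b'.

(* Main.v *)
Require Import Defs.
From HB Require Import structures.
From mathcomp Require Import all_boot all_order all_algebra.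
From mathcomp Require Import reals.
From mathcomp Require Import complex.
From mathcomp Require Import perm.

Set Implicit Arguments.
Unset Strict Implicit.
Unset Printing Implicit Defensive.

Import Order.TTheory GRing.Theory Num.Theory.
Local Open Scope ring_scope.

(* The characteristic polynomial of the ring is
   [prod_i (X - a_i) - c], where [c] is, up to sign, the product of the [b_i].
   Its multiple roots are critical points [z] of [P = prod_i (X - a_i)] with
   [P(z) = c], so they occur for finitely many values of [c] only.  Since
   [prod_i (b_i + t)] is a nonconstant polynomial in [t], all but finitely many
   translations [b + (t, ..., t)] avoid these values. *)

Lemma val_iter_ordS n (i : 'I_n) k : iter k (@ordS n) i = ((i + k) %% n)%N :> nat.
Proof.
elim: k => [|k IHk] /=; first by rewrite addn0 modn_small.
by rewrite IHk -addn1 modnDml addn1 addnS.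
Qed.

Lemma ordS_transitive n (i j : 'I_n) : exists k, iter k (@ordS n) i = j.
Proof.
(* Going [n - i] steps wraps around to index 0; [j] further steps reach [j]. *)
exists (n - i + j)%N; apply: val_inj; rewrite /= val_iter_ordS.
by rewrite addnA subnKC ?modnDl ?modn_small // ltnW.
Qed.

Lemma ordS_neq n (i : 'I_n) : (1 < n)%N -> ordS i != i.
Proof.
move=> n_gt1; apply/negP => /eqP/(congr1 val) /= iE.
have [i_lt|] := ltnP i.+1 n.
  by move: iE; rewrite modn_small // => /eqP; rewrite -[X in _ == X]addn0 -addn1 eqn_add2l.
move=> n_le; have niE : n = i.+1 by apply/eqP; rewrite eqn_leq n_le ltn_ord.
move: iE; rewrite -niE modnn => i0.
have: (1 < i.+1)%N by rewrite -niE.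
by rewrite -i0.
Qed.

(** Moved points propagate around the ring: if [s] sends [i] to [ordS i], injectivity forbids it to
    fix [ordS i] as well, unless [i] was fixed. One moved point therefore forces a full cyclic
    shift. *)
Lemma perm_ring n (s : 'S_n) :
  (forall i, (s i == i) || (s i == ordS i)) ->
  s = 1%g \/ s = perm (@ordS_inj n).
Proof.
move=> s_ring; have [/forallP s_fix|] := boolP [forall i, s i == i].
  by left; apply/permP => i; rewrite perm1; apply/eqP.
rewrite negb_forall => /existsP[i0 s_i0]; right.
have step i : s i != i -> s (ordS i) != ordS i.
  move=> s_i; have /orP[/eqP siE|/eqP siE] := s_ring i.
    by rewrite siE eqxx in s_i.
  by apply: contra s_i => /eqP; rewrite -siE => /perm_inj/eqP.
apply/permP => i; rewrite permE; have [k <-] := ordS_transitive i0 i.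
have moved : s (iter k (@ordS n) i0) != iter k (@ordS n) i0.
  by elim: k => //= k; apply: step.
by have := s_ring (iter k (@ordS n) i0); rewrite (negPf moved) => /eqP.
Qed.

(** In the Leibniz expansion only the identity and the cyclic shift avoid zero entries, and they are
    distinct because [1 < n]. The general ring [K] allows polynomial entries; the exponent is the
    parity of the shift. *)
Lemma det_ring (K : comNzRingType) n (a b : 'I_n -> K) : (1 < n)%N ->
  \det (\matrix_(i, j) if j == i then a i else if j == ordS i then b i else 0)
  = \prod_i a i + (-1) ^+ perm (@ordS_inj n) * \prod_i b i.
Proof.
move=> n_gt1; rewrite /determinant (bigD1 (1%g : 'S_n)) //=.
rewrite odd_perm1 mul1r (bigD1 (perm (@ordS_inj n))) /=; last first.
  apply/eqP => /permP/(_ (Ordinal (ltnW n_gt1))); rewrite permE perm1.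
  by apply/eqP/ordS_neq.
rewrite [X in _ + (_ + X)]big1 ?addr0 => [|s /andP[s_n1 s_nS]].
  congr (_ + _ * _); apply: eq_bigr => i _; rewrite mxE.
    by rewrite perm1 eqxx.
  by rewrite permE (negPf (ordS_neq i n_gt1)) eqxx.
have [i s_i] : exists i, ~~ ((s i == i) || (s i == ordS i)).
  apply/existsP; rewrite -negb_forall; apply/negP => /forallP/perm_ring.
  by case=> sE; [rewrite sE eqxx in s_n1 | rewrite sE eqxx in s_nS].
move: s_i; rewrite negb_or => /andP[/negPf si /negPf siS].
by rewrite (bigD1 i) //= mxE si siS mul0r mulr0.
Qed.

Lemma char_poly_ring (R : realType) n (a b : 'rV[R]_n) : (1 < n)%N ->
  char_poly (complexify (ring_jacobian a b)) =
  \prod_i ('X - ((a 0 i)%:C%C)%:P)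
  + ((-1) ^+ (perm (@ordS_inj n) + n) * \prod_i (b 0 i)%:C%C)%:P.
Proof.
move=> n_gt1; transitivity (\det (\matrix_(i, j)
    if j == i then 'X - ((a 0 i)%:C%C)%:P
    else if j == ordS i then - ((b 0 i)%:C%C)%:P else 0)).
  congr (\det _); apply/matrixP => i j; rewrite !mxE [i == j]eq_sym.
  case: eqP => // _; rewrite mulr0n add0r.
  by case: eqP; rewrite ?rmorph0 ?raddf0.
rewrite det_ring //; congr (_ + _).
(* The [n] entries [- b_i] contribute the extra sign [(-1) ^+ n]. *)
by rewrite prodrN card_ord polyCM rmorphXn rmorphN rmorph1 rmorph_prod exprD mulrA.
Qed.

Lemma deriv_neq0 (R : numDomainType) (p : {poly R}) :
  (1 < size p)%N -> p^`() != 0.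
Proof.
move=> p_gt1; have p_n0 : p != 0 by rewrite -size_poly_gt0 ltnW.
(* The top coefficient of the derivative is a positive integer multiple of the leading coefficient
   of [p], nonzero in characteristic 0. *)
apply/eqP => /polyP/(_ (size p).-2)/eqP.
rewrite coef_deriv coef0 mulrn_eq0 /= -lead_coef_eq0 lead_coefE in p_n0 *.
by rewrite prednK ?(negPf p_n0) // -ltnS prednK // ltnW.
Qed.

Lemma mup_simple_root (F : fieldType) (p : {poly F}) z :
  root p z -> ~~ root p^`() z -> mup z p = 1%N.
Proof.
move=> pz p'z; have p_n0 : p != 0.
  by apply: contraNneq p'z => ->; rewrite deriv0 root0.
apply/eqP; rewrite eqn_leq mup_leq // -XsubC_dvd // dvdp_XsubCl pz andbT.
apply: contra p'z => /dvdpP[q ->]; rewrite expr2 mulrA derivM derivXsubC.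
by rewrite rootE hornerD !hornerM hornerXsubC subrr !(mulr0, mul0r) addr0.
Qed.

(** The [size q] distinct points [eps / (k + 2)] lie strictly between 0 and [eps], and they are too
    many to be all roots of [q]. *)
Lemma small_nonroot (R : realType) (q : {poly R[i]}) (eps : R) :
  q != 0 -> 0 < eps -> exists t, [/\ 0 < t, t < eps & ~~ root q t%:C%C].
Proof.
move=> q_n0 eps_gt0.
pose t k : R := eps / k.+2%:R.
pose s := [seq (t k)%:C%C | k <- iota 0 (size q)].
have t_inj : injective t.
  by move=> k l /(mulfI (lt0r_neq0 eps_gt0))/invr_inj/eqP; rewrite eqr_nat => /eqP[].
have s_uniq : uniq s.
  rewrite map_inj_in_uniq ?iota_uniq // => k l _ _ /complexI; exact: t_inj.
have /allPn[_ /mapP[k _ ->] q_t] : ~~ all (root q) s.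
  apply/negP => s_roots; have := max_poly_roots q_n0 s_roots s_uniq.
  by rewrite size_map size_iota ltnn.
exists (t k); split=> //; first by rewrite divr_gt0 ?ltr0Sn.
by rewrite ltr_pdivrMr ?ltr0Sn // ltr_pMr // ltr1n.
Qed.

Lemma enorm_const_lt (R : realType) n (t eps : R) :
  0 < t -> t < eps / n.+1%:R -> enorm (const_mx t : 'rV_n) < eps.
Proof.
move=> t_gt0; rewrite ltr_pdivlMr ?ltr0Sn // => t_lt; rewrite /enorm.
have eps_gt0 : 0 < eps by rewrite (lt_trans _ t_lt) // mulr_gt0 ?ltr0Sn.
rewrite -[ltRHS]gtr0_norm // -sqrtr_sqr ltr_sqrt ?exprn_gt0 //.
under eq_bigr do rewrite mxE.
rewrite sumr_const card_ord -mulr_natr.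
(* The crude bound [n <= (n + 1) ^ 2] suffices here, and dividing by [n + 1] is always safe. *)
apply: (@le_lt_trans _ _ ((t * n.+1%:R) ^+ 2)); last first.
  by rewrite ltrXn2r // ltW // mulr_gt0 ?ltr0Sn.
rewrite exprMn ler_wpM2l ?sqr_ge0 // -natrX ler_nat.
exact: leq_trans (leqnSn n) (leq_pmulr _ _).
Qed.

Lemma enorm_row0mx (R : realType) m n (v : 'rV[R]_n) :
  enorm (row_mx (0 : 'rV_m) v) = enorm v.
Proof.
rewrite /enorm big_split_ord /= big1 => [|i _]; last first.
  by rewrite row_mxEl mxE expr0n.
by rewrite add0r; under eq_bigr do rewrite row_mxEr.
Qed.

Lemma ring_simple_perturbation (R : realType) n (a b : 'rV[R]_n) (eps : R) :
  (1 < n)%N -> 0 < eps ->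
  exists b' : 'rV[R]_n,
    enorm (b' - b) < eps /\ all_eigenvalues_simple (ring_jacobian a b').
Proof.
move=> n_gt1 eps_gt0.
pose P : {poly R[i]} := \prod_i ('X - ((a 0 i)%:C%C)%:P).
pose u : R[i] := (-1) ^+ (perm (@ordS_inj n) + n).
pose B : {poly R[i]} := \prod_i ('X - (- (b 0 i)%:C%C)%:P).
have sz (F : 'I_n -> R[i]) : size (\prod_i ('X - (F i)%:P)) = n.+1.
  by rewrite size_prod_XsubC /index_enum -enumT size_enum_ord.
have P'_n0 : P^`() != 0 by rewrite deriv_neq0 // sz ltnW.
have [r P'E] := closed_field_poly_normal P^`().
(* As [z] runs over the critical points of [P], the factor of [z], evaluated at [t], is the value at
   [z] of the characteristic polynomial for [b + (t, ..., t)]. *)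
pose q := \prod_(z <- r) (u *: B + (P.[z])%:P).
have q_n0 : q != 0.
  rewrite prodf_seq_neq0; apply/allP => z _; rewrite implyTb -size_poly_gt0.
  (* [u *: B] has degree [n > 0], so adding the constant [P.[z]] cannot cancel it. *)
  have szB : size (u *: B) = n.+1 by rewrite size_scale ?signr_eq0 // sz.
  by rewrite size_polyDl szB // (leq_ltn_trans (size_polyC_leq1 _)) // ltnS ltnW.
have [t [t_gt0 t_lt q_t]] := small_nonroot q_n0 (divr_gt0 eps_gt0 (ltr0Sn R n)).
exists (b + const_mx t); split; first by rewrite addrC addKr enorm_const_lt.
move=> z; rewrite eigenvalue_root_char /simple_eigenvalue char_poly_ring //.
set c := (X in _ + X%:P); rewrite -/P => pz; apply: mup_simple_root => //.
(* The constant [c] disappears on differentiation, so a multiple root [z] belongs to the list [r],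
   which does not depend on [t]; its factor would make [q] vanish at [t]. *)
rewrite derivD derivC addr0; apply: contra q_t => P'z.
have z_r : z \in r.
  by move: P'z; rewrite P'E rootZ ?lead_coef_eq0 // root_prod_XsubC.
rewrite /q (big_rem z) //= rootM; apply/orP; left.
move: pz; rewrite !rootE !hornerE addrC => /eqP <-; apply/eqP.
congr (_ * _ + _); rewrite horner_prod; apply: eq_bigr => i _.
by rewrite !hornerE !mxE rmorphD opprK addrC.
Qed.

Theorem theorem4p1 (R : realType) (n : nat) (hn : (2 <= n)%N) :
  generic (fun a b : 'rV[R]_n => all_eigenvalues_simple (ring_jacobian a b)) /\
  (forall (a b : 'rV[R]_n) (eps : R), 0 < eps ->
     exists b' : 'rV[R]_n,
       enorm (b' - b) < eps /\ all_eigenvalues_simple (ring_jacobian a b')).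
Proof.
split=> a b eps eps_gt0; last exact: ring_simple_perturbation.
have [b' [b'b simple]] := ring_simple_perturbation a b hn eps_gt0.
by exists a, b'; rewrite subrr enorm_row0mx.
Qed.
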